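(* Let $X$ and $A$ be nonempty sets and let $F\colon A\to\mathcal P(X)$ be a soft set with $F(t)\neq\varnothing$ for every $t\in A$ and $\mathrm{SE}(F)\neq\varnothing$. Let $(F,\tau_1,\tau_2)$ be a soft bitopological space. For each $j\in\{0,1,2\}$, $(F,\tau_1,\tau_2)$ is pairwise soft $T_j$ if and only if the bitopological space $(\mathrm{SE}(F),\tau_1^{\mathrm e},\tau_2^{\mathrm e})$ is pairwise $T_j$.
   Context: A soft set over $X$ with parameter set $A$ is a map $H\colon A\to\mathcal P(X)$; it is a soft subset of $F$, written $H\subseteq_s F$, if $H(t)\subseteq F(t)$ for every $t\in A$. Soft unions (arbitrary) and soft intersections (finite) are taken pointwise in $t$. The null soft set $\Phi$ is $\Phi(t)=\varnothing$ for all $t\in A$. A soft element of $F$ is a map $a\colon A\to X$ with $a(t)\in F(t)$ for every $t\in A$; $\mathrm{SE}(F)$ is the set of all soft elements of $F$. For $H\subseteq_s F$, $\mathrm{SE}(H)=\{a\in\mathrm{SE}(F):a(t)\in H(t)\text{ for every }t\in A\}$; write $a\in_s H$ if $a\in\mathrm{SE}(H)$ and $a\notin_s H$ otherwise. A soft topology on $F$ is a family $\tau$ of soft subsets of $F$ with $\Phi,F\in\tau$, closed under arbitrary soft unions and finite soft intersections. The induced soft-element topology of $\tau$ is the topology on $\mathrm{SE}(F)$ with basis $\{\mathrm{SE}(H):H\in\tau\}$, i.e. $\tau^{\mathrm e}=\{\bigcup_{H\in\mathcal H}\mathrm{SE}(H):\mathcal H\subseteq\tau\}$. A soft bitopological space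 is a triple $(F,\tau_1,\tau_2)$ with $\tau_1,\tau_2$ soft topologies on $F$. $(F,\tau_1,\tau_2)$ is: - pairwise soft $T_0$ if for all distinct $a,b\in\mathrm{SE}(F)$ either there is $H\in\tau_1$ with $a\in_s H$, $b\notin_s H$, or there is $K\in\tau_2$ with $b\in_s K$, $a\notin_s K$; - pairwise soft $T_1$ if for all distinct $a,b\in\mathrm{SE}(F)$ there are $H\in\tau_1$, $K\in\tau_2$ with $a\in_s H$, $b\notin_s H$, $b\in_s K$, $a\notin_s K$; - pairwise soft $T_2$ if for all distinct $a,b\in\mathrm{SE}(F)$ there are $H\in\tau_1$, $K\in\tau_2$ with $a\in_s H$, $b\in_s K$, $\mathrm{SE}(H)\cap\mathrm{SE}(K)=\varnothing$. A bitopological space $(Y,\sigma_1,\sigma_2)$ (two topologies on a set $Y$) is: - pairwise $T_0$ if for all distinct $x,y\in Y$ either there is $U\in\sigma_1$ with $x\in U$, $y\notin U$, or there is $V\in\sigma_2$ with $y\in V$, $x\notin V$; - pairwise $T_1$ if for all distinct $x,y\in Y$ there are $U\in\sigma_1$, $V\in\sigma_2$ with $x\in U$, $y\notin U$, $y\in V$, $x\notin V$; - pairwise $T_2$ if for all distinct $x,y\in Y$ there are $U\in\sigma_1$, $V\in\sigma_2$ with $x\in U$, $y\in V$, $U\cap V=\varnothing$. *)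

(* Defs.v *)
From HB Require Import structures.
From mathcomp Require Import all_boot all_order.
From mathcomp Require Import all_classical topology_structure.
Set Implicit Arguments.
Unset Strict Implicit.
Unset Printing Implicit Defensive.
Local Open Scope classical_set_scope.

Section SoftSets.
Variables (X A : Type).

Definition soft_set := A -> set X.

Definition soft_subset (H F : soft_set) := forall t, H t `<=` F t.

Definition soft_null : soft_set := fun=> set0.

Definition soft_union (G : set soft_set) : soft_set :=
  fun t => \bigcup_(H in G) H t.

Definition soft_inter (H K : soft_set) : soft_set := fun t => H t `&` K t.

Definition SE (F : soft_set) : set (A -> X) := [set a | forall t, F t (a t)].

(* SE(F) as a type, and SE(H) as a subset of it *)
Definition soft_elt (F : soft_set) : Type := set_type (SE F).
HB.instance Definition _ (F : soft_set) := gen_eqMixin (soft_elt F).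
HB.instance Definition _ (F : soft_set) := gen_choiceMixin (soft_elt F).

Definition SEin (F H : soft_set) : set (soft_elt F) := [set a | SE H (val a)].

(* The empty finite intersection is F itself, so the binary case suffices. *)
Record soft_topology (F : soft_set) := SoftTopology {
  soft_open : set soft_set;
  soft_open_sub : forall H, soft_open H -> soft_subset H F;
  soft_open_null : soft_open soft_null;
  soft_open_full : soft_open F;
  soft_open_union : forall G : set soft_set,
    G `<=` soft_open -> soft_open (soft_union G);
  soft_open_inter : forall H K,
    soft_open H -> soft_open K -> soft_open (soft_inter H K)
}.

Record soft_bitopology (F : soft_set) := SoftBitopology {
  soft_top1 : soft_topology F;
  soft_top2 : soft_topology F
}.

End SoftSets.

Section SoftSeparation.
Variables (X A : Type) (F : soft_set X A) (S : soft_bitopology F).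

Local Notation tau1 := (soft_open (soft_top1 S)).
Local Notation tau2 := (soft_open (soft_top2 S)).
Local Notation "a '\ins' H" := (SEin H a) (at level 70).

Definition pairwise_soft_T0 := forall a b : soft_elt F, a <> b ->
  (exists H, [/\ tau1 H, a \ins H & ~ b \ins H]) \/
  (exists K, [/\ tau2 K, b \ins K & ~ a \ins K]).

Definition pairwise_soft_T1 := forall a b : soft_elt F, a <> b ->
  exists H K, [/\ tau1 H, tau2 K, a \ins H /\ ~ b \ins H &
                  b \ins K /\ ~ a \ins K].

Definition pairwise_soft_T2 := forall a b : soft_elt F, a <> b ->
  exists H K, [/\ tau1 H, tau2 K, a \ins H, b \ins K &
                  @SEin X A F H `&` @SEin X A F K = set0].

End SoftSeparation.

(* [Topological Y] is the type of topologies on Y. *)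
Record bitopologicalType := Bitopological {
  bitop_sort :> Type;
  bitop1 : Topological bitop_sort;
  bitop2 : Topological bitop_sort
}.

Section Bitopological.
Variable Y : bitopologicalType.

Definition open1 : set (set Y) := @open (Topological.Pack (bitop1 Y)).
Definition open2 : set (set Y) := @open (Topological.Pack (bitop2 Y)).

Definition pairwise_T0 := forall x y : Y, x <> y ->
  (exists U, [/\ open1 U, U x & ~ U y]) \/
  (exists V, [/\ open2 V, V y & ~ V x]).

Definition pairwise_T1 := forall x y : Y, x <> y ->
  exists U V, [/\ open1 U, open2 V, U x /\ ~ U y & V y /\ ~ V x].

Definition pairwise_T2 := forall x y : Y, x <> y ->
  exists U V, [/\ open1 U, open2 V, U x, V y & U `&` V = set0].

End Bitopological.

Arguments pairwise_T0 : clear implicits.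
Arguments pairwise_T1 : clear implicits.
Arguments pairwise_T2 : clear implicits.

(* SE(F), as a type carrying the induced soft-element topology of tau *)
Definition soft_elt_space (X A : Type) (F : soft_set X A)
  (tau : soft_topology F) : Type := soft_elt F.

Section InducedTopology.
Variables (X A : Type) (F : soft_set X A) (tau : soft_topology F).
Local Notation T := (soft_elt_space tau).

Definition se_open : set (set T) :=
  [set \bigcup_(H in G) @SEin X A F H | G in [set G | G `<=` soft_open tau]].

Let se_openT : se_open [set: T].
Proof.
exists [set F]; first by move=> _ ->; exact: soft_open_full.
rewrite bigcup_set1 -subTset => a _.
exact: set_valP a.
Qed.

Let se_openI : setI_closed se_open.
Proof.
move=> _ _ [G Gtau <-] [G' G'tau <-].
exists [set L | exists H K, [/\ G H, G' K & L = soft_inter H K]].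
  by move=> _ [H [K [GH G'K ->]]]; apply: soft_open_inter; [exact: Gtau|exact: G'tau].
apply/seteqP; split => a.
  move=> [_ [H [K [GH G'K ->]]] aHK].
  by split; [exists H|exists K] => // t; have [] := aHK t.
move=> [[H GH aH] [K G'K aK]].
exists (soft_inter H K); first by exists H, K.
by move=> t; split; [exact: aH|exact: aK].
Qed.

Let se_open_bigU (I : Type) (g : I -> set T) :
  (forall i, se_open (g i)) -> se_open (\bigcup_i g i).
Proof.
move=> og.
exists [set H | soft_open tau H /\ exists i, @SEin X A F H `<=` g i]; first by move=> H [].
apply/seteqP; split => a.
  by move=> [H [_ [i Hg]] aH]; exists i => //; exact: Hg.
move=> [i _ ga]; have [G Gtau gE] := og i.
move: ga; rewrite -gE => -[H GH aH]; exists H => //.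
split; first exact: Gtau.
by exists i; rewrite -gE => b bH; exists H.
Qed.

HB.instance Definition _ := Choice.copy T (soft_elt F).
HB.instance Definition _ :=
  isOpenTopological.Build T se_openT se_openI se_open_bigU.

Lemma se_openE : @open T = se_open.
Proof. by []. Qed.

End InducedTopology.

Definition induced_topology (X A : Type) (F : soft_set X A)
  (tau : soft_topology F) : Topological (soft_elt F) :=
  Topological.on (soft_elt_space tau).

Definition induced_bitop (X A : Type) (F : soft_set X A)
  (S : soft_bitopology F) : bitopologicalType :=
  Bitopological (induced_topology (soft_top1 S))
                (induced_topology (soft_top2 S)).

Lemma open1_induced (X A : Type) (F : soft_set X A) (S : soft_bitopology F) :
  @open1 (induced_bitop S) = @se_open X A F (soft_top1 S).
Proof. by []. Qed.

Lemma open2_induced (X A : Type) (F : soft_set X A) (S : soft_bitopology F) :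
  @open2 (induced_bitop S) = @se_open X A F (soft_top2 S).
Proof. by []. Qed.

(* Main.v *)
(** Every induced open set is a union of sets [SE H] with [H] soft open, so each
    point of it lies in some [SE H] contained in it. The separation axioms only
    ask for small neighbourhoods of points, hence they can be tested on this basis. *)
Require Import Defs.
From mathcomp Require Import all_boot all_order.
From mathcomp Require Import all_classical topology_structure.
Local Open Scope classical_set_scope.

Lemma se_open_SEin (X A : Type) (F : soft_set X A) (tau : soft_topology F)
    (H : soft_set X A) : soft_open tau H -> se_open (tau := tau) (SEin H).
Proof. by move=> tauH; exists [set H]; [move=> _ -> | rewrite bigcup_set1]. Qed.

(** A point of a union lies in one of its members. This turns an open witness back into a soft open
    one. *)
Lemma se_open_basis (X A : Type) (F : soft_set X A) (tau : soft_topology F)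
    (U : set (soft_elt F)) (a : soft_elt F) :
  se_open (tau := tau) U -> U a ->
  exists H, [/\ soft_open tau H, SEin H a & SEin H `<=` U].
Proof.
move=> [G Gtau <-] [H GH aH]; exists H; split=> //; first exact: Gtau.
by move=> b bH; exists H.
Qed.

Theorem theorem4p5 (X A : Type) (X_neq0 : [set: X] !=set0)
    (A_neq0 : [set: A] !=set0) (F : soft_set X A)
    (F_neq0 : forall t : A, F t !=set0) (SEF_neq0 : SE F !=set0)
    (S : soft_bitopology F) :
  (pairwise_soft_T0 S <-> pairwise_T0 (induced_bitop S)) /\
  (pairwise_soft_T1 S <-> pairwise_T1 (induced_bitop S)) /\
  (pairwise_soft_T2 S <-> pairwise_T2 (induced_bitop S)).
Proof.
rewrite /pairwise_T0 /pairwise_T1 /pairwise_T2 open1_induced open2_induced.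
(* Both sides range over the same pairs of distinct points of [soft_elt F], so only the witnesses
   need converting. *)
split; [|split]; split=> sep a b /sep.
- move=> [[H [tauH aH bH]]|[K [tauK bK aK]]]; [left|right].
  + by exists (SEin H); split=> //; exact: se_open_SEin.
  + by exists (SEin K); split=> //; exact: se_open_SEin.
- move=> [[U [oU Ua Ub]]|[V [oV Vb Va]]]; [left|right].
  + have [H [tauH aH HU]] := se_open_basis _ _ _ _ _ _ oU Ua.
    (* Shrinking [U] to [SEin H] keeps [a] and cannot bring [b] back in. *)
    by exists H; split=> // /HU.
  + have [K [tauK bK KV]] := se_open_basis _ _ _ _ _ _ oV Vb.
    by exists K; split=> // /KV.
- move=> [H [K [tauH tauK aHb bKa]]].
  by exists (SEin H), (SEin K); split=> //; exact: se_open_SEin.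
- move=> [U [V [oU oV [Ua Ub] [Vb Va]]]].
  have [H [tauH aH HU]] := se_open_basis _ _ _ _ _ _ oU Ua.
  have [K [tauK bK KV]] := se_open_basis _ _ _ _ _ _ oV Vb.
  by exists H, K; split=> //; split=> //; [move/HU|move/KV].
- move=> [H [K [tauH tauK aH bK HK0]]].
  by exists (SEin H), (SEin K); split=> //; exact: se_open_SEin.
- move=> [U [V [oU oV Ua Vb UV0]]].
  have [H [tauH aH HU]] := se_open_basis _ _ _ _ _ _ oU Ua.
  have [K [tauK bK KV]] := se_open_basis _ _ _ _ _ _ oV Vb.
  exists H, K; split=> //.
  (* Disjointness passes to subsets: [SEin H] and [SEin K] can meet only where [U] and [V] do. *)
  by rewrite -subset0 -UV0; exact: setISS.
Qed.
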